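(* Let $\mathfrak{n}_3(\mathbb{R})$ be the real Heisenberg Lie algebra, with basis $(e_1,e_2,e_3)$ and only non-trivial bracket $[e_1,e_2]=e_3$ (up to antisymmetry). The classification, up to isomorphism of algebras, of LR-algebra structures on $\mathfrak{n}_3(\mathbb{R})$ is given by the following list, i.e. every LR-algebra with associated Lie algebra isomorphic to $\mathfrak{n}_3(\mathbb{R})$ is isomorphic to exactly one of the following LR-algebras (products of basis vectors not listed are zero): (1) $A_1(\alpha)$, $\alpha\in\mathbb{R}$: $e_1\cdot e_1=e_3$, $e_1\cdot e_2=e_3$, $e_2\cdot e_2=\alpha e_3$; (2) $A_2(\beta)$, $\beta\in\mathbb{R}$: $e_1\cdot e_2=\beta e_3$, $e_2\cdot e_1=(\beta-1)e_3$, $e_2\cdot e_2=e_1$; (3) $A_3$: $e_1\cdot e_2=\tfrac12 e_3$, $e_2\cdot e_1=-\tfrac12 e_3$; (4) $A_4$: $e_2\cdot e_1=-e_3$, $e_2\cdot e_2=e_2$, $e_2\cdot e_3=e_3$, $e_3\cdot e_2=e_3$. All of these LR-algebras are complete, except for $A_4$, which is not complete.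
   Context: An LR-algebra over a field is an algebra $(A,\cdot)$ with bilinear product satisfying $x\cdot(y\cdot z)=y\cdot(x\cdot z)$ and $(x\cdot y)\cdot z=(x\cdot z)\cdot y$ for all $x,y,z\in A$. The commutator $[x,y]=x\cdot y-y\cdot x$ is then a Lie bracket, and $A$ with this bracket is the associated Lie algebra of $A$; an LR-algebra structure on a Lie algebra $\mathfrak{g}$ is an LR-algebra product on the vector space $\mathfrak{g}$ whose commutator is the given bracket. An LR-algebra is complete if all left multiplications $L(x)\colon y\mapsto x\cdot y$ are nilpotent. *)

(* Defs.v *)
From HB Require Import structures.
From mathcomp Require Import all_boot all_order all_algebra.
From mathcomp Require Import ring.
From mathcomp Require Import reals.

Set Implicit Arguments.
Unset Strict Implicit.
Unset Printing Implicit Defensive.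

Import GRing.Theory.
Local Open Scope ring_scope.

(* Algebras over a field: no associativity, no unit and no bound on the
   dimension are assumed. *)
Record nalgebra (K : fieldType) := NAlgebra {
  nalgebra_sort :> lmodType K;
  amul : {bilinear nalgebra_sort -> nalgebra_sort -> nalgebra_sort}
}.

Definition isomorphic (K : fieldType) (A B : nalgebra K) : Prop :=
  exists f : {linear A -> B},
    bijective f /\ forall x y : A, f (amul A x y) = amul B (f x) (f y).

(* Lie algebras are regarded as algebras whose product is the bracket. *)
Definition is_Lie (K : fieldType) (g : nalgebra K) : Prop :=
  (forall x : g, amul g x x = 0) /\
  (forall x y z : g,
     amul g x (amul g y z) + amul g y (amul g z x) + amul g z (amul g x y) = 0).

Definition is_LR (K : fieldType) (A : nalgebra K) : Prop :=
  (forall x y z : A, amul A x (amul A y z) = amul A y (amul A x z)) /\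
  (forall x y z : A, amul A (amul A x y) z = amul A (amul A x z) y).

Definition commutator (K : fieldType) (A : nalgebra K) (x y : A) : A :=
  amul A x y - amul A y x.

Lemma commutator_is_bilinear (K : fieldType) (A : nalgebra K) :
  bilinear_for *:%R *:%R (@commutator K A).
Proof.
split=> u a x y; rewrite /commutator /= linearPl linearPr scalerBr opprD addrACA //.
Qed.

HB.instance Definition _ (K : fieldType) (A : nalgebra K) :=
  bilinear_isBilinear.Build K A A A *:%R *:%R (@commutator K A)
    (@commutator_is_bilinear K A).

Definition associated_Lie (K : fieldType) (A : nalgebra K) : nalgebra K :=
  @NAlgebra K A (@commutator K A).

Lemma associated_Lie_is_Lie (K : fieldType) (A : nalgebra K) :
  is_LR A -> is_Lie (associated_Lie A).
Proof.
case=> hL hR; split=> [x | x y z] /=; first by rewrite /commutator subrr.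
rewrite /commutator !linearBl !linearBr /=.
rewrite (hL y x z) (hL z x y) (hL z y x) (hR y x z) (hR z x y) (hR x y z).
have tri (p q r : A) : p - q + (r - p) + (q - r) = 0.
  by rewrite [p - q + _]addrC !subrKA subrr.
rewrite [_ - _ + (_ - _)]addrACA -opprD [X in X = 0]addrACA -opprD tri.
by rewrite sub0r !subrKA subrr oppr0.
Qed.

Definition LR_structure_on (K : fieldType) (g : nalgebra K)
    (m : {bilinear g -> g -> g}) : Prop :=
  is_LR (NAlgebra m) /\ forall x y : g, m x y - m y x = amul g x y.

Definition complete (K : fieldType) (A : nalgebra K) : Prop :=
  forall x : A, exists k : nat, forall y : A, iter k (amul A x) y = 0.

Definition e1 (K : fieldType) : 'rV[K]_3 := delta_mx 0 0.
Definition e2 (K : fieldType) : 'rV[K]_3 := delta_mx 0 1.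
Definition e3 (K : fieldType) : 'rV[K]_3 := delta_mx 0 2.
Arguments e1 {K}.
Arguments e2 {K}.
Arguments e3 {K}.

(* The bilinear product on K^3 with e_i . e_j = c i j, where the indices of [c]
   start at 1. *)
Definition table_mul (K : fieldType) (c : nat -> nat -> 'rV[K]_3)
    (u v : 'rV[K]_3) : 'rV[K]_3 :=
  \sum_(i < 3) \sum_(j < 3) (u 0 i * v 0 j) *: c i.+1 j.+1.

Lemma table_mul_is_bilinear (K : fieldType) (c : nat -> nat -> 'rV[K]_3) :
  bilinear_for *:%R *:%R (table_mul c).
Proof.
split=> w a u v; rewrite /table_mul /= scaler_sumr -big_split /=;
  apply: eq_bigr => i _; rewrite scaler_sumr -big_split /=;
  apply: eq_bigr => j _; rewrite scalerA -scalerDl !mxE; congr (_ *: _); ring.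
Qed.

HB.instance Definition _ (K : fieldType) (c : nat -> nat -> 'rV[K]_3) :=
  bilinear_isBilinear.Build K 'rV[K]_3 'rV[K]_3 'rV[K]_3 *:%R *:%R (table_mul c)
    (@table_mul_is_bilinear K c).

Lemma table_mul_delta (K : fieldType) (c : nat -> nat -> 'rV[K]_3) (i j : 'I_3) :
  table_mul c (delta_mx 0 i) (delta_mx 0 j) = c i.+1 j.+1.
Proof.
rewrite /table_mul (bigD1 i) //= [X in _ + X]big1 => [|k kNi]; last first.
  by rewrite big1 // => l _; rewrite !mxE (negPf kNi) mul0r scale0r.
rewrite addr0 (bigD1 j) //= big1 => [|k kNj]; last first.
  by rewrite !mxE (negPf kNj) mulr0 scale0r.
by rewrite !mxE !eqxx mulr1 scale1r addr0.
Qed.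

Definition heisenberg_table (K : fieldType) (i j : nat) : 'rV[K]_3 :=
  match i, j with
  | 1%N, 2%N => e3
  | 2%N, 1%N => - e3
  | _, _ => 0
  end.

Definition heisenberg (K : fieldType) : nalgebra K :=
  @NAlgebra K 'rV[K]_3 (table_mul (@heisenberg_table K)).

Lemma heisenberg_is_Lie (K : fieldType) : is_Lie (heisenberg K).
Proof.
have brE (u v : 'rV[K]_3) : table_mul (@heisenberg_table K) u v =
    (u 0 0 * v 0 1 - u 0 1 * v 0 0) *: e3.
  rewrite /table_mul !big_ord_recl !big_ord0 /= !scaler0 !addr0 !add0r.
  rewrite scalerN -scalerBl; congr ((_ * _ - _ * _) *: _);
    by congr (_ 0 _); apply: val_inj.
split=> [x | x y z] /=; rewrite !brE.
  by rewrite mulrC subrr scale0r.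
by rewrite !mxE /= !mulr0 !subrr !scale0r !addr0.
Qed.

Inductive LR_index (K : fieldType) : Type :=
| A1 (alpha : K)
| A2 (beta : K)
| A3
| A4.
Arguments A3 {K}.
Arguments A4 {K}.

Definition LR_table (K : fieldType) (s : LR_index K) (i j : nat) : 'rV[K]_3 :=
  match s with
  | A1 alpha =>
      match i, j with
      | 1%N, 1%N => e3
      | 1%N, 2%N => e3
      | 2%N, 2%N => alpha *: e3
      | _, _ => 0
      end
  | A2 beta =>
      match i, j with
      | 1%N, 2%N => beta *: e3
      | 2%N, 1%N => (beta - 1) *: e3
      | 2%N, 2%N => e1
      | _, _ => 0
      end
  | A3 =>
      match i, j with
      | 1%N, 2%N => 2^-1 *: e3
      | 2%N, 1%N => - 2^-1 *: e3
      | _, _ => 0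
      end
  | A4 =>
      match i, j with
      | 2%N, 1%N => - e3
      | 2%N, 2%N => e2
      | 2%N, 3%N => e3
      | 3%N, 2%N => e3
      | _, _ => 0
      end
  end.

Definition LR_algebra (K : fieldType) (s : LR_index K) : nalgebra K :=
  @NAlgebra K 'rV[K]_3 (table_mul (LR_table s)).

(* Main.v *)
Require Import Defs.
From HB Require Import structures.
From mathcomp Require Import all_boot all_order all_algebra.
From mathcomp Require Import ring.
From mathcomp Require Import boolp reals.

Set Implicit Arguments.
Unset Strict Implicit.
Unset Printing Implicit Defensive.

Import GRing.Theory.
Local Open Scope ring_scope.

(** Let A be an LR-algebra whose commutator is a Heisenberg bracket, written
    [u, v] = w(u, v) z with z central and w an alternating form whose radical
    is the line K z.

    The two LR identities say that left multiplications commute and that right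
    multiplications commute; together they make every left multiplication a
    derivation of the bracket ([lmul_derivation]).  A derivation preserves the
    centre, so x z = z x = l(x) z ([lmul_center], [rmul_center]), where l(x) is
    the trace of L(x) on the commutative quotient A / K z
    ([center_char_trace]), and l is multiplicative ([center_charM]).

    If l is not zero, then A / K z has a basis formed by an idempotent and an
    element of square zero which annihilate each other.  The idempotent lifts
    to A, and a central correction of the other vector gives the multiplication
    table of A4 ([LR_center_char_neq0]).

    If l is zero, then L(x) has trace zero on the plane A / K z, that is,
    w(xu, v) is symmetric in u and v ([area_mulCA]); as the quotient is
    commutative, w(xy, t) is a symmetric trilinear form.  If the cubic form
    w(xx, x) does not vanish at x, then xx and x generate A and their products
    are those of A2 ([LR_cubic_neq0]).  Otherwise polarization shows that all
    products are central ([cubic_eq0_mul_center]), so that the product is a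
    bilinear form b with values in K z, with skew part w / 2.  A vector with
    b(x, x) <> 0 starts a basis as in A1 ([LR_square_neq0]); if there is none,
    b = w / 2 and A is A3 ([LR_square_eq0]).

    The algebras of the list are told apart by properties that isomorphisms
    preserve.  Only A4 is not complete; in A3 all squares vanish; in A2(beta)
    the identity (xx)x = beta [xx, x] determines beta, whereas in A1 both sides
    are zero; finally alpha is the value on A1(alpha) of
    (b(x, x) b(y, y) - b(x, y) b(y, x)) / w(x, y)^2, a discriminant of b that
    does not depend on x and y. *)

Local Notation "x ** y" := (amul _ x y) (at level 40, left associativity).

(** * Isomorphisms and multiplication tables *)

Lemma isomorphic_sym (K : fieldType) (A B : nalgebra K) :
  isomorphic A B -> isomorphic B A.
Proof.
case=> f [[g fK gK] fM].
pose g' : {linear B -> A} := HB.pack g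
  (GRing.isLinear.Build _ _ _ _ g (can2_linear fK gK)).
exists g'; split; first by exists f.
by move=> x y; apply: (can_inj fK); rewrite /= fM !gK.
Qed.

Lemma isomorphic_trans (K : fieldType) (A B C : nalgebra K) :
  isomorphic A B -> isomorphic B C -> isomorphic A C.
Proof.
case=> f [f_bij fM] [g [g_bij gM]]; exists (g \o f).
split; first exact: bij_comp.
by move=> x y /=; rewrite fM gM.
Qed.

Lemma linear_rV_inj_bij (K : fieldType) n (f : {linear 'rV[K]_n -> 'rV[K]_n}) :
  injective f -> bijective f.
Proof.
move=> f_inj; have f_unit : lin1_mx f \in unitmx.
  rewrite -row_free_unit; apply: inj_row_free => u.
  by rewrite mul_rV_lin1 => fu0; apply: f_inj; rewrite fu0 linear0.
exists (mulmxr (invmx (lin1_mx f))) => u /=.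
  by rewrite -mul_rV_lin1 mulmxK.
by rewrite -mul_rV_lin1 mulmxKV.
Qed.

(** Linear combinations of a family of vectors, bundled as a linear map out of the
    row vectors so that its bijectivity says that the family is a basis. *)
Section Lincomb.
Variables (K : fieldType) (n : nat) (V : lmodType K) (x : 'I_n -> V).

Definition lincomb (u : 'rV[K]_n) : V := \sum_i u 0 i *: x i.

Lemma lincomb_is_linear : linear lincomb.
Proof.
move=> a u v; rewrite /lincomb scaler_sumr -big_split /=.
by apply: eq_bigr => i _; rewrite !mxE scalerDl scalerA.
Qed.

HB.instance Definition _ :=
  GRing.isLinear.Build K 'rV[K]_n V _ lincomb lincomb_is_linear.

Lemma lincomb_delta i : lincomb (delta_mx 0 i) = x i.
Proof.
rewrite /lincomb (bigD1 i) //= big1 => [|j jNi]; last first.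
  by rewrite !mxE (negPf jNi) scale0r.
by rewrite !mxE !eqxx scale1r addr0.
Qed.

End Lincomb.

(** How an algebra is recognized: by bilinearity a basis that multiplies
    according to a table is enough. *)
Lemma table_isomorphic (K : fieldType) (A : nalgebra K)
    (c : nat -> nat -> 'rV[K]_3) (x : 'I_3 -> A) :
  bijective (lincomb x) ->
  (forall i j : 'I_3, x i ** x j = lincomb x (c i.+1 j.+1)) ->
  isomorphic A (@NAlgebra K 'rV[K]_3 (table_mul c)).
Proof.
move=> x_basis xM; apply: isomorphic_sym; exists (lincomb x).
split=> // u v /=; rewrite [in RHS]/lincomb linear_sumlz linear_sum.
apply: eq_bigr => i _; rewrite linear_sumr linear_sum; apply: eq_bigr => j _.
by rewrite linearZ_LR linearZl_LR linearZr_LR /= xM scalerA.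
Qed.

Lemma rV3P (K : fieldType) (u v : 'rV[K]_3) :
  u 0 0 = v 0 0 -> u 0 1 = v 0 1 -> u 0 2 = v 0 2 -> u = v.
Proof.
move=> e0 e1 e2; apply/rowP => -[[|[|[|//]]] lt_i].
- by rewrite (_ : Ordinal _ = 0) //; apply: val_inj.
- by rewrite (_ : Ordinal _ = 1) //; apply: val_inj.
- by rewrite (_ : Ordinal _ = 2) //; apply: val_inj.
Qed.

Lemma sum3 (V : nmodType) (F : 'I_3 -> V) : \sum_i F i = F 0 + F 1 + F 2.
Proof.
have o1 : lift ord0 ord0 = 1 :> 'I_3 by apply: val_inj.
have o2 : lift ord0 (lift ord0 ord0) = 2 :> 'I_3 by apply: val_inj.
by rewrite !big_ord_recl big_ord0 /= o1 o2 addr0 addrA.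
Qed.

Lemma table_mulE (K : fieldType) (c : nat -> nat -> 'rV[K]_3) (u v : 'rV[K]_3) :
  table_mul c u v =
    (u 0 0 * v 0 0) *: c 1%N 1%N + (u 0 0 * v 0 1) *: c 1%N 2%N
    + (u 0 0 * v 0 2) *: c 1%N 3%N + (u 0 1 * v 0 0) *: c 2%N 1%N
    + (u 0 1 * v 0 1) *: c 2%N 2%N + (u 0 1 * v 0 2) *: c 2%N 3%N
    + (u 0 2 * v 0 0) *: c 3%N 1%N + (u 0 2 * v 0 1) *: c 3%N 2%N
    + (u 0 2 * v 0 2) *: c 3%N 3%N.
Proof.
by rewrite /table_mul !sum3 !addrA.
Qed.

(** * Algebras whose commutator is a Heisenberg bracket *)

Section HeisenbergType.
Variables (K : fieldType) (A : nalgebra K).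
Variables (g : {linear A -> 'rV[K]_3}) (h : 'rV[K]_3 -> A).
Hypotheses (gK : cancel g h) (hK : cancel h g).
Hypothesis gM : forall x y : A,
  g (commutator x y) = table_mul (@heisenberg_table K) (g x) (g y).

(** The alternating form w with [u, v] = w(u, v) z, computed in the coordinates g;
    it is the area form of the plane A / K z. *)
Definition area (u v : A) : K := g u 0 0 * g v 0 1 - g u 0 1 * g v 0 0.

Lemma areaDl u v w : area (u + v) w = area u w + area v w.
Proof. by rewrite /area linearD !mxE; ring. Qed.
Lemma areaDr u v w : area u (v + w) = area u v + area u w.
Proof. by rewrite /area linearD !mxE; ring. Qed.
Lemma areaZl a u v : area (a *: u) v = a * area u v.
Proof. by rewrite /area linearZ !mxE; ring. Qed.
Lemma areaZr a u v : area u (a *: v) = a * area u v.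
Proof. by rewrite /area linearZ !mxE; ring. Qed.
Lemma area0l u : area 0 u = 0.
Proof. by rewrite /area linear0 !mxE; ring. Qed.
Lemma area0r u : area u 0 = 0.
Proof. by rewrite /area linear0 !mxE; ring. Qed.
Lemma areaC u v : area u v = - area v u.
Proof. by rewrite /area; ring. Qed.
Lemma areaxx u : area u u = 0.
Proof. by rewrite /area; ring. Qed.

Definition center_gen : A := h e3.
Local Notation z := center_gen.

Lemma comm_area (u v : A) : u ** v - v ** u = area u v *: z.
Proof.
apply: (can_inj gK); rewrite [LHS]gM linearZ /= hK table_mulE /=.
by rewrite /area !scaler0 !add0r !addr0 scalerN scalerBl.
Qed.

Lemma center_neq0 : z != 0.
Proof.
apply/eqP => /(congr1 g); rewrite hK linear0 => /rowP /(_ 2).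
by rewrite !mxE !eqxx => /eqP; rewrite oner_eq0.
Qed.

Lemma areazl u : area z u = 0.
Proof. by rewrite /area hK !mxE /=; ring. Qed.
Lemma areazr u : area u z = 0.
Proof. by rewrite areaC areazl oppr0. Qed.

Lemma scale_center_inj : injective ( *:%R^~ z).
Proof.
move=> a b /= /eqP; rewrite -subr_eq0 -scalerBl scaler_eq0 (negPf center_neq0).
by rewrite orbF subr_eq0 => /eqP.
Qed.

(** The radical of the area form is the line of z: pairing to zero with two
    vectors that span A / K z forces v to be central. *)
Lemma centerP (v x y : A) :
  area x y != 0 -> area v x = 0 -> area v y = 0 -> exists c, v = c *: z.
Proof.
move=> xy_neq0 vx vy; exists (g v 0 2); apply: (can_inj gK).
rewrite linearZ /= hK.
have [v0 v1] : g v 0 0 = 0 /\ g v 0 1 = 0.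
  move: xy_neq0 vx vy; rewrite /area => xy_neq0 vx vy.
  split; apply: (mulfI xy_neq0); rewrite mulr0.
    transitivity (g x 0 0 * (g v 0 0 * g y 0 1 - g v 0 1 * g y 0 0)
      - g y 0 0 * (g v 0 0 * g x 0 1 - g v 0 1 * g x 0 0)); first by ring.
    by rewrite vx vy !mulr0 subr0.
  transitivity (g x 0 1 * (g v 0 0 * g y 0 1 - g v 0 1 * g y 0 0)
    - g y 0 1 * (g v 0 0 * g x 0 1 - g v 0 1 * g x 0 0)); first by ring.
  by rewrite vx vy !mulr0 subr0.
by apply: rV3P; rewrite !mxE /= ?v0 ?v1 ?mulr0 ?mulr1.
Qed.

Definition frame (x1 x2 x3 : A) (i : 'I_3) : A := nth 0 [:: x1; x2; x3] i.

Lemma lincomb_frame x1 x2 x3 u :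
  lincomb (frame x1 x2 x3) u = u 0 0 *: x1 + u 0 1 *: x2 + u 0 2 *: x3.
Proof. exact: sum3. Qed.

(** Pairing a linear relation with x2 and with x1 kills its first two
    coefficients, so the three vectors are independent. *)
Lemma frame_basis x1 x2 d :
  area x1 x2 != 0 -> d != 0 -> bijective (lincomb (frame x1 x2 (d *: z))).
Proof.
move=> x12 d_neq0; set f := lincomb _.
have gf_bij : bijective (g \o f).
  apply: linear_rV_inj_bij; apply: raddf_inj => u /= /(congr1 h).
  rewrite gK -[X in h X](linear0 g) gK /f lincomb_frame => fu0.
  have u0 : u 0 0 = 0.
    move/(congr1 (area^~ x2)): fu0.
    rewrite !areaDl !areaZl areazl areaxx !mulr0 !addr0 area0l => /eqP.
    by rewrite mulf_eq0 (negPf x12) orbF => /eqP.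
  have u1 : u 0 1 = 0.
    move/(congr1 (area x1)): fu0.
    rewrite !areaDr !areaZr areazr areaxx !mulr0 add0r addr0 area0r => /eqP.
    by rewrite mulf_eq0 (negPf x12) orbF => /eqP.
  move/eqP: fu0; rewrite u0 u1 !scale0r !add0r scalerA scaler_eq0.
  rewrite (negPf center_neq0) orbF mulf_eq0 (negPf d_neq0) orbF => /eqP u2.
  by apply: rV3P; rewrite !mxE.
have h_bij : bijective h by exists g.
by apply: (eq_bij (bij_comp h_bij gf_bij)) => u /=; rewrite gK.
Qed.

(** * The character by which the algebra acts on the centre *)

Hypothesis A_LR : is_LR A.
Let lmulC (x y w : A) : x ** (y ** w) = y ** (x ** w). Proof. exact: A_LR.1. Qed.
Let rmulC (x y w : A) : x ** y ** w = x ** w ** y. Proof. exact: A_LR.2. Qed.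

(** Both sides equal u(xv) - v(xu): commuting left multiplications rewrite the
    left side, and (xu)v = (xv)u cancels the rest of the right side. *)
Lemma lmul_derivation (x u v : A) :
  x ** (u ** v - v ** u) =
    (x ** u ** v - v ** (x ** u)) + (u ** (x ** v) - x ** v ** u).
Proof.
rewrite linearBr /= (lmulC x u v) (lmulC x v u) (rmulC x u v).
by rewrite [RHS]addrC addrA subrK.
Qed.

(** The trace of L(x) on A / K z, in the basis given by the coordinates. *)
Definition center_char (x : A) : K :=
  area (x ** h e1) (h e2) + area (h e1) (x ** h e2).
Local Notation lam := center_char.

Lemma area_std : area (h e1) (h e2) = 1.
Proof. by rewrite /area !hK !mxE /=; ring. Qed.

(** Apply the derivation L(x) to z, which is the bracket of the first two basis
    vectors. *)
Lemma lmul_center x : x ** z = lam x *: z.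
Proof.
rewrite -[z in LHS]scale1r -area_std -comm_area lmul_derivation !comm_area.
by rewrite -scalerDl.
Qed.

Lemma rmul_center x : z ** x = lam x *: z.
Proof.
rewrite -lmul_center; apply/eqP.
by rewrite -subr_eq0 comm_area areazl scale0r.
Qed.

Lemma center_char_trace x u v : area (x ** u) v + area u (x ** v) = lam x * area u v.
Proof.
apply: scale_center_inj; rewrite /= scalerDl -!comm_area -lmul_derivation.
by rewrite comm_area linearZr_LR /= lmul_center scalerA mulrC.
Qed.

(** Evaluate x(zy) = z(xy) in two ways. *)
Lemma center_charM x y : lam (x ** y) = lam x * lam y.
Proof.
apply: scale_center_inj; rewrite /= -rmul_center lmulC rmul_center.
by rewrite linearZr_LR /= lmul_center scalerA mulrC.
Qed.

Lemma center_charD x y : lam (x + y) = lam x + lam y.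
Proof. by rewrite /center_char !linearDl /= areaDl areaDr addrACA. Qed.
Lemma center_charZ a x : lam (a *: x) = a * lam x.
Proof. by rewrite /center_char !linearZl_LR /= !areaZl !areaZr; ring. Qed.

(** Commutativity of A / K z, seen through the area form. *)
Lemma area_mulC x y u : area (x ** y) u = area (y ** x) u.
Proof.
rewrite -[x ** y](subrK (y ** x)) comm_area areaDl areaZl areazl mulr0.
by rewrite add0r.
Qed.

Lemma center_char_z : lam z = 0.
Proof.
rewrite /center_char !rmul_center areaZl areazl areaZr areazr; ring.
Qed.

Lemma frameP (x1 x2 v : A) : area x1 x2 = 1 ->
  exists c, v = area v x2 *: x1 + area x1 v *: x2 + c *: z.
Proof.
move=> x12.
have [||| c vE] := @centerP (v - area v x2 *: x1 - area x1 v *: x2) x1 x2.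
- by rewrite x12 oner_eq0.
- rewrite !areaDl -!scaleNr !areaZl areaxx (areaC x2) (areaC v) x12; ring.
- rewrite !areaDl -!scaleNr !areaZl areaxx x12; ring.
by exists c; rewrite -vE -[v - _ - _]addrA -opprD [RHS]addrC subrK.
Qed.

(** The third vector of a frame is a free multiple of z; the tables then force
    it to be the bracket of the other two. *)
Lemma frame_isomorphic (s : LR_index K) x1 x2 d :
  area x1 x2 != 0 -> d != 0 ->
  (let x := frame x1 x2 (d *: z) in
   forall i j, x i ** x j = lincomb x (LR_table s i.+1 j.+1)) ->
  isomorphic A (LR_algebra s).
Proof. by move=> x12 d0; apply: table_isomorphic; apply: frame_basis. Qed.

Lemma lincomb_e1 x1 x2 x3 : lincomb (frame x1 x2 x3) e1 = x1.
Proof. exact: lincomb_delta. Qed.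
Lemma lincomb_e2 x1 x2 x3 : lincomb (frame x1 x2 x3) e2 = x2.
Proof. exact: lincomb_delta. Qed.
Lemma lincomb_e3 x1 x2 x3 : lincomb (frame x1 x2 x3) e3 = x3.
Proof. exact: lincomb_delta. Qed.
Let lincombE := (lincomb_e1, lincomb_e2, lincomb_e3).

(** * Nonzero character: the algebra A4 *)

Lemma LR_center_char_neq0 x0 : lam x0 != 0 -> isomorphic A (LR_algebra A4).
Proof.
move=> lam_x0.
have [n [u [n0 u1 nu]]] : exists n u, [/\ lam n = 0, lam u = 1 & area n u = 1].
  have [c x0E] := @frameP (h e1) (h e2) x0 area_std.
  (* The kernel of the linear form lam modulo the centre, scaled so that pairing
     with n is lam itself. *)
  pose n := lam (h e2) *: h e1 - lam (h e1) *: h e2.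
  exists n, ((lam x0)^-1 *: x0); split.
  - by rewrite /n center_charD -scaleNr !center_charZ; ring.
  - by rewrite center_charZ mulVf.
  rewrite areaZr /n areaDl -scaleNr !areaZl (areaC (h e2)).
  apply: (mulfI lam_x0); rewrite mulVKf // mulr1 [in RHS]x0E.
  rewrite !center_charD !center_charZ center_char_z; ring.
have char_area v : area n v = lam v.
  have [c vE] := @frameP n u v nu.
  by rewrite [in RHS]vE !center_charD !center_charZ center_char_z n0 u1; ring.
(* A product v n lies in the kernel of lam, hence is a multiple of n modulo z; as
   L(v) has trace 1 and its eigenvalue modulo n is lam v = 1, the multiple is 0. *)
have mul_n v : lam v = 1 -> exists p, v ** n = p *: z.
  move=> v1; apply: (@centerP _ n v); first by rewrite char_area v1 oner_eq0.
    by rewrite areaC char_area center_charM n0 mulr0 oppr0.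
  have := center_char_trace v n v; rewrite !char_area center_charM v1 !mulr1.
  by move/(canRL (addrK _)); rewrite subrr.
have [p un] := mul_n u u1.
have [q nn] : exists q, n ** n = q *: z.
  apply: (@centerP _ n u); first by rewrite nu oner_eq0.
    by rewrite areaC char_area center_charM n0 mulr0 oppr0.
  have := center_char_trace n n u; rewrite nu char_area center_charM n0 !mul0r.
  by rewrite addr0.
have nuE : n ** u = (p + 1) *: z.
  by rewrite -[n ** u](subrK (u ** n)) comm_area nu un -scalerDl addrC.
have [c uuE] := @frameP n u (u ** u) nu.
rewrite char_area center_charM u1 mul1r scale1r in uuE.
set d := area _ _ in uuE.
(* Modulo z, u u is u plus a multiple of n; as n annihilates everything modulo z,
   u u is idempotent modulo z. *)
have [a eeE] : exists a, (u ** u) ** (u ** u) = u ** u + a *: z.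
  exists (d * (d * q) + d * p + (d * (p + 1) + c) + c).
  rewrite {1 2}uuE !(linearDl, linearDr) /= !(linearZl_LR, linearZr_LR) /=.
  rewrite !(lmul_center, rmul_center) nn un nuE n0 u1 center_char_z.
  rewrite !(scale0r, scaler0) !addr0.
  rewrite !scalerA !mulr1 add0r [(d * p) *: z + _]addrC -!addrA.
  rewrite !(addrCA _ (u ** u)) -!scalerDl.
  by congr (_ + _ *: _); ring.
(* As (u u) z = z (u u) = z, subtracting c z from u u changes its square by
   - 2 c z, so c = a gives an idempotent. *)
pose e := u ** u - a *: z.
have char_e : lam e = 1.
  rewrite /e -scaleNr center_charD center_charZ center_char_z center_charM u1; ring.
have ee : e ** e = e.
  rewrite {1 2}/e !linearBl !linearBr /= !(linearZl_LR, linearZr_LR) /= eeE.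
  rewrite lmul_center !rmul_center center_charM u1 mulr1 scale1r center_char_z scale0r.
  by rewrite !scaler0 subr0 addrK.
have [r en] := mul_n e char_e.
have neE : n ** e = (r + 1) *: z.
  by rewrite -[n ** e](subrK (e ** n)) comm_area char_area char_e en -scalerDl addrC.
(* The correction of n that is annihilated by e on the right. *)
pose m := n - (r + 1) *: z.
have me : m ** e = 0.
  by rewrite linearBl /= linearZl_LR /= rmul_center char_e scale1r neE subrr.
have m0 : lam m = 0.
  by rewrite /m -scaleNr center_charD center_charZ n0 center_char_z; ring.
have em : e ** m = - z.
  rewrite /m linearBr /= linearZr_LR /= lmul_center char_e scale1r en -scalerBl.
  by rewrite opprD addNKr scaleN1r.
have mmE : m ** m = q *: z.
  rewrite {1 2}/m !linearBl !linearBr /= !(linearZl_LR, linearZr_LR) /=.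
  rewrite lmul_center !rmul_center n0 center_char_z !scale0r !scaler0 !subr0.
  exact: nn.
(* The right multiplications by m and by e commute and the latter fixes z:
   q z = (m m) e = (m e) m = 0. *)
have mm : m ** m = 0.
  have := rmulC m m e; rewrite me linear0l mmE linearZl_LR /= rmul_center char_e.
  by rewrite scale1r.
apply: (@frame_isomorphic A4 m e 1).
- by rewrite /m areaDl -scaleNr areaZl areazl mulr0 addr0 char_area char_e oner_eq0.
- exact: oner_neq0.
rewrite scale1r => x [[|[|[|//]]] ?] [[|[|[|//]]] ?] /=.
all: rewrite /x ?linearN ?linear0 /= ?lincombE /frame /= //.
all: rewrite ?lmul_center ?rmul_center ?m0 ?char_e ?center_char_z ?scale0r ?scale1r //.
Qed.

(** * Zero character: the algebras A1, A2 and A3 *)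

Hypotheses (two_neq0 : 2 != 0 :> K) (three_neq0 : 3 != 0 :> K).

Section Nilpotent.
Hypothesis center_char0 : forall x, lam x = 0.

(** An operator on a plane has trace zero exactly when it is skew for the area
    form.  With [area_mulC] this makes w(xu, v) symmetric in its three
    arguments. *)
Lemma area_mulCA x u v : area (x ** u) v = area (x ** v) u.
Proof.
have /eqP := center_char_trace x u v; rewrite center_char0 mul0r addr_eq0 => /eqP ->.
by rewrite areaC opprK.
Qed.

Lemma mul_center_l x d : (d *: z) ** x = 0.
Proof. by rewrite linearZl_LR /= rmul_center center_char0 scale0r scaler0. Qed.
Lemma mul_center_r x d : x ** (d *: z) = 0.
Proof. by rewrite linearZr_LR /= lmul_center center_char0 scale0r scaler0. Qed.

(** The vectors xx and x span A / K z.  The symmetries of w(xy, t) make (xx)x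
    orthogonal to both, hence central, and then (xx)(xx) = x((xx)x) is 0. *)
Lemma LR_cubic_neq0 x : area (x ** x) x != 0 ->
  exists beta, isomorphic A (LR_algebra (A2 beta)).
Proof.
set d := area _ x => d_neq0.
have [p Xx] : exists p, x ** x ** x = p *: z.
  apply: (@centerP _ (x ** x) x d_neq0).
    (* Write X for xx.  Commuting L(X) and L(x) turns w(X x, X) = w(X X, x) into
       w(x (X x), x) = w(x x, X x) = - w(X x, X). *)
    have : 2 * area (x ** x ** x) (x ** x) = 0.
      rewrite mulr_natl mulr2n {2}area_mulCA (lmulC (x ** x)).
      by rewrite (area_mulCA x) [X in _ + X]areaC subrr.
    by move/eqP; rewrite mulf_eq0 (negPf two_neq0) => /eqP.
  by rewrite area_mulC area_mulCA areaxx.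
have xX : x ** (x ** x) = (p - d) *: z.
  by rewrite scalerBl -Xx -comm_area subKr.
have XX : x ** x ** (x ** x) = 0 by rewrite lmulC Xx mul_center_r.
exists (p / d); apply: (@frame_isomorphic _ (x ** x) x d) => // y.
move=> [[|[|[|//]]] ?] [[|[|[|//]]] ?] /=.
all: rewrite /y /= ?mul_center_l ?mul_center_r ?linear0 //.
all: rewrite ?linearZ /= ?lincombE ?scalerA ?mulrBl ?mul1r ?divfK //.
Qed.

(** Polarization: over a field where 6 is invertible, a symmetric trilinear form
    is determined by its cubic form. *)
Lemma cubic_eq0_mul_center : (forall x, area (x ** x) x = 0) ->
  forall x y : A, x ** y = g (x ** y) 0 2 *: z.
Proof.
move=> cub0.
have T2 x y : area (x ** x) y = 0.
  have cubD u v :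
      3 * area (u ** u) v + 3 * area (v ** v) u = 0.
    have uvu : area (u ** v) u = area (u ** u) v by rewrite area_mulCA.
    have vuv : area (v ** u) v = area (v ** v) u by rewrite area_mulCA.
    have := cub0 (u + v); rewrite !(linearDl, linearDr) /= !(areaDl, areaDr) !cub0.
    rewrite (area_mulC v u u) (area_mulC u v v) uvu vuv => <-; ring.
  have := cubD x (- y); rewrite !(linearNl, linearNr) /= opprK -scaleN1r areaZr.
  move=> cubB.
  have /eqP : 2 * 3 * area (x ** x) y = 0.
    transitivity ((3 * area (x ** x) y + 3 * area (y ** y) x) -
     (3 * (-1 * area (x ** x) y) + 3 * area (y ** y) x)); first by ring.
    by rewrite cubB cubD subrr.
  by rewrite !mulf_eq0 (negPf two_neq0) (negPf three_neq0) => /eqP.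
have T3 x y w : area (x ** y) w = 0.
  have := T2 (x + y) w; rewrite !(linearDl, linearDr) /= !areaDl !T2 (area_mulC y x).
  rewrite add0r addr0 -mulr2n -mulr_natl => /eqP.
  by rewrite mulf_eq0 (negPf two_neq0) => /eqP.
move=> x y.
have [|c xyE] := @centerP (x ** y) (h e1) (h e2) _ (T3 _ _ _) (T3 _ _ _).
  by rewrite area_std oner_eq0.
by rewrite xyE linearZ /= hK !mxE mulr1.
Qed.

Hypothesis mul_center : forall x y : A, x ** y = g (x ** y) 0 2 *: z.

(** Write xy = b(x, y) z.  A vector y with w(x, y) <> 0 is corrected by a multiple
    of x to have yx = 0, then scaled so that xx = xy. *)
Lemma LR_square_neq0 (x : A) : x ** x != 0 ->
  exists alpha, isomorphic A (LR_algebra (A1 alpha)).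
Proof.
pose b u v := g (u ** v) 0 2.
have bE u v : u ** v = b u v *: z by apply: mul_center.
rewrite bE scaler_eq0 (negPf center_neq0) orbF; set q := b x x => q_neq0.
have [y0 xy0] : exists y, area x y = 1.
  have [xe1 | xe1] := eqVneq (area x (h e1)) 0; last first.
    by exists ((area x (h e1))^-1 *: h e1); rewrite areaZr mulVf.
  have [xe2 | xe2] := eqVneq (area x (h e2)) 0; last first.
    by exists ((area x (h e2))^-1 *: h e2); rewrite areaZr mulVf.
  have [|c xE] := centerP _ xe1 xe2; first by rewrite area_std oner_eq0.
  by move/eqP: q_neq0; rewrite /q /b xE mul_center_l linear0 mxE.
pose y := q *: y0 - b y0 x *: x.
have yx : y ** x = 0.
  rewrite /y linearBl /= !linearZl_LR /= bE [x ** x]bE -/q !scalerA mulrC subrr //.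
have xy_area : area x y = q.
  by rewrite /y areaDr -scaleNr !areaZr areaxx xy0; ring.
have xy : x ** y = q *: z.
  by have := comm_area x y; rewrite yx subr0 xy_area.
exists (b y y / q); apply: (@frame_isomorphic _ x y q) => //; first by rewrite xy_area.
move=> x' [[|[|[|//]]] ?] [[|[|[|//]]] ?] /=.
all: rewrite /x' /= ?mul_center_l ?mul_center_r ?linear0 //.
all: rewrite ?linearZ /= ?lincombE ?scalerA ?divfK //.
Qed.

(** An alternating b equals its skew part w / 2. *)
Lemma LR_square_eq0 : (forall x : A, x ** x = 0) -> isomorphic A (LR_algebra A3).
Proof.
move=> sq0; pose x := h e1; pose y := h e2.
have yxE : y ** x = - (x ** y).
  apply/eqP; rewrite -addr_eq0; apply/eqP.
  have := sq0 (x + y); rewrite !(linearDl, linearDr) /= !sq0 add0r addr0.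
  by rewrite addrC.
have xyE : x ** y = 2^-1 *: z.
  have := comm_area x y; rewrite yxE opprK area_std -mulr2n -scaler_nat => /eqP.
  rewrite scale1r => /eqP <-; rewrite scalerA mulVf ?scale1r //.
apply: (@frame_isomorphic _ x y 1); rewrite ?area_std ?oner_neq0 // scale1r.
move=> x' [[|[|[|//]]] ?] [[|[|[|//]]] ?] /=.
all: rewrite /x' ?linearZ ?linear0 /= ?lincombE /frame /= //.
all: rewrite ?lmul_center ?rmul_center ?center_char0 ?scale0r //.
by rewrite yxE xyE scaleNr.
Qed.

End Nilpotent.

Lemma LR_classification : exists s, isomorphic A (LR_algebra s).
Proof.
have [[x x_neq0] | center_char0] := pselect (exists x, lam x != 0).
  by exists A4; apply: LR_center_char_neq0 x_neq0.
have {}center_char0 x : lam x = 0.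
  by apply/eqP/negPn/negP => x_neq0; apply: center_char0; exists x.
have [[x x_neq0] | cub0] := pselect (exists x, area (x ** x) x != 0).
  by have [b] := LR_cubic_neq0 center_char0 x_neq0; exists (A2 b).
have {}cub0 x : area (x ** x) x = 0.
  by apply/eqP/negPn/negP => x_neq0; apply: cub0; exists x.
have mulC := cubic_eq0_mul_center center_char0 cub0.
have [[x x_neq0] | sq0] := pselect (exists x : A, x ** x != 0).
  by have [a] := LR_square_neq0 center_char0 mulC x_neq0; exists (A1 a).
exists A3; apply: LR_square_eq0 => // x.
by apply/eqP/negPn/negP => x_neq0; apply: sq0; exists x.
Qed.

End HeisenbergType.

(** * Properties invariant under isomorphism *)

Lemma isomorphic_complete (K : fieldType) (A B : nalgebra K) :
  isomorphic A B -> complete B -> complete A.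
Proof.
case=> f [f_bij fM] B_complete x; have [k xk0] := B_complete (f x); exists k => y.
have fE i : f (iter i (amul A x) y) = iter i (amul B (f x)) (f y).
  by elim: i => //= i <-; rewrite fM.
by apply: (bij_inj f_bij); rewrite fE xk0 linear0.
Qed.

Definition alternating (K : fieldType) (A : nalgebra K) :=
  forall x : A, x ** x = 0.

Lemma isomorphic_alternating (K : fieldType) (A B : nalgebra K) :
  isomorphic A B -> alternating B -> alternating A.
Proof.
case=> f [f_bij fM] B_alt x.
by apply: (bij_inj f_bij); rewrite fM linear0.
Qed.

(** The identity that recovers the parameter of A2. *)
Definition cubic_ratio (K : fieldType) (A : nalgebra K) (b : K) :=
  forall x : A, x ** x ** x = b *: commutator (x ** x) x.

Lemma isomorphic_cubic_ratio (K : fieldType) (A B : nalgebra K) b :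
  isomorphic A B -> cubic_ratio B b -> cubic_ratio A b.
Proof.
case=> f [f_bij fM] B_ratio x.
by apply: (bij_inj f_bij); rewrite linearZ /commutator linearB /= !fM; apply: B_ratio.
Qed.

(** The determinant of a bilinear form with values in a line, measured in the
    unit [x, y].  The entry of the product yx is c - 1, whence c (c - 1).  Taking
    [x, y] as the unit makes the value invariant under change of basis. *)
Definition quadratic_invariant (K : fieldType) (A : nalgebra K) (t : K) :=
  forall (x y : A) (a b c : K),
    x ** x = a *: commutator x y -> y ** y = b *: commutator x y ->
    x ** y = c *: commutator x y -> commutator x y != 0 ->
    a * b - c * (c - 1) = t.

Lemma isomorphic_quadratic_invariant (K : fieldType) (A B : nalgebra K) t :
  isomorphic A B -> quadratic_invariant B t -> quadratic_invariant A t.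
Proof.
case=> f [f_bij fM] B_inv x y a b c xx yy xy xy_neq0.
have f_comm : commutator (f x) (f y) = f (commutator x y).
  by rewrite linearB /= !fM.
apply: (B_inv (f x) (f y)); rewrite -?fM f_comm ?xx ?yy ?xy ?linearZ //.
by rewrite -(linear0 f) (inj_eq (bij_inj f_bij)).
Qed.

(** * The algebras of the list *)

Section Table.
Variable K : fieldType.
Implicit Type s : LR_index K.

Lemma e1_neq0 : e1 != 0 :> 'rV[K]_3.
Proof. by apply/eqP => /rowP /(_ 0); rewrite !mxE => /eqP; rewrite oner_eq0. Qed.
Lemma e2_neq0 : e2 != 0 :> 'rV[K]_3.
Proof. by apply/eqP => /rowP /(_ 1); rewrite !mxE => /eqP; rewrite oner_eq0. Qed.
Lemma e3_neq0 : e3 != 0 :> 'rV[K]_3.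
Proof. by apply/eqP => /rowP /(_ 2); rewrite !mxE => /eqP; rewrite oner_eq0. Qed.

Lemma LR_mulE s (u v : 'rV[K]_3) : table_mul (LR_table s) u v =
  match s with
  | A1 alpha =>
      (u 0 0 * v 0 0 + u 0 0 * v 0 1 + alpha * (u 0 1 * v 0 1)) *: e3
  | A2 beta => (u 0 1 * v 0 1) *: e1
      + (beta * (u 0 0 * v 0 1) + (beta - 1) * (u 0 1 * v 0 0)) *: e3
  | A3 => (2^-1 * (u 0 0 * v 0 1 - u 0 1 * v 0 0)) *: e3
  | A4 => (u 0 1 * v 0 1) *: e2
      + (u 0 1 * v 0 2 + u 0 2 * v 0 1 - u 0 1 * v 0 0) *: e3
  end.
Proof.
rewrite table_mulE; case: s => [a|b||] /=; apply: rV3P; rewrite !mxE /=; ring.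
Qed.

Lemma LR_table_structure (two_neq0 : 2 != 0 :> K) s :
  @LR_structure_on K (heisenberg K) (amul (LR_algebra s)).
Proof.
split=> [|x y].
  by case: s => [a|b||]; split=> x y w /=; rewrite !LR_mulE; apply: rV3P;
    rewrite !mxE /=; ring.
rewrite /= !LR_mulE table_mulE.
by case: s => [a|b||] /=; apply: rV3P; rewrite !mxE /=; field.
Qed.

Lemma LR_complete s : s <> A4 -> complete (LR_algebra s).
Proof.
by case: s => [a|b||] // _ x; exists 3 => y /=; rewrite !LR_mulE; apply: rV3P;
  rewrite !mxE /=; ring.
Qed.

Lemma A4_not_complete : ~ complete (LR_algebra (@A4 K)).
Proof.
move/(_ e2) => [k /(_ e2)]; apply/eqP.
suff -> : iter k (amul (LR_algebra (@A4 K)) e2) e2 = e2 by exact: e2_neq0.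
by elim: k => // k IHk; rewrite iterS IHk; apply: table_mul_delta.
Qed.

Lemma A3_alternating : alternating (LR_algebra (@A3 K)).
Proof. by move=> x; rewrite /= LR_mulE mulrC [X in X - _]mulrC subrr mul0r scale0r. Qed.

(** Both sides vanish: squares are multiples of e3, which annihilates the algebra. *)
Lemma A1_cubic_ratio (a b : K) : cubic_ratio (LR_algebra (A1 a)) b.
Proof.
move=> x; rewrite /commutator /= !LR_mulE; apply: rV3P; rewrite !mxE /=; ring.
Qed.

Lemma A2_cubic_ratio (b : K) : cubic_ratio (LR_algebra (A2 b)) b.
Proof.
move=> x; rewrite /commutator /= !LR_mulE; apply: rV3P; rewrite !mxE /=; ring.
Qed.

(** At e2 one has (e2 e2) e2 = b e3 and [e2 e2, e2] = e3. *)
Lemma A2_cubic_ratio_inj (b c : K) : cubic_ratio (LR_algebra (A2 b)) c -> b = c.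
Proof.
move/(_ e2) => /rowP /(_ 2).
rewrite /commutator /= !LR_mulE !mxE /= => bc.
by apply/subr0_eq; move/eqP: bc; rewrite -subr_eq0 => /eqP <-; ring.
Qed.

(** In coordinates b(x, x) b(y, y) - b(x, y) b(y, x) = a w(x, y)^2, to be divided
    by w(x, y)^2. *)
Lemma A1_quadratic_invariant (a : K) : quadratic_invariant (LR_algebra (A1 a)) a.
Proof.
move=> x y p q r; rewrite /commutator /= !LR_mulE -!scalerBl !scalerA.
set w := (_ - _) => xx yy xy; rewrite scaler_eq0 (negPf e3_neq0) orbF => w_neq0.
have e3_inj c d : c *: e3 = d *: e3 :> 'rV[K]_3 -> c = d.
  by move=> /rowP /(_ 2); rewrite !mxE /= !mulr1.
move/e3_inj: xx => xx; move/e3_inj: yy => yy; move/e3_inj: xy => xy.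
apply: (mulIf (mulf_neq0 w_neq0 w_neq0)).
transitivity ((p * w) * (q * w) - (r * w) * (r * w - w)); first by ring.
by rewrite -xx -yy -xy /w; ring.
Qed.

Lemma LR_isomorphic_eq s t :
  isomorphic (LR_algebra s) (LR_algebra t) -> s = t.
Proof.
have not_A4 (u : LR_index K) : isomorphic (LR_algebra u) (LR_algebra A4) -> u = A4.
  case: u => [a|b||] // /isomorphic_sym /isomorphic_complete H;
    by case: A4_not_complete; apply: H; apply: LR_complete.
have A1e1 (a : K) : ~ alternating (LR_algebra (A1 a)).
  by move/(_ e1) => /eqP; rewrite /= table_mul_delta /= (negPf e3_neq0).
have A2e2 (b : K) : ~ alternating (LR_algebra (A2 b)).
  by move/(_ e2) => /eqP; rewrite /= table_mul_delta /= (negPf e1_neq0).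
(* Every ratio is allowed in A1, but only b in A2(b); test b + 1. *)
have A1_A2 (a b : K) : ~ isomorphic (LR_algebra (A2 b)) (LR_algebra (A1 a)).
  move/isomorphic_cubic_ratio => /(_ (b + 1)) /(_ (@A1_cubic_ratio _ _)).
  move/A2_cubic_ratio_inj/eqP; rewrite -subr_eq0 opprD addNKr.
  by rewrite oppr_eq0 oner_eq0.
have not_A3 (u : LR_index K) : isomorphic (LR_algebra u) (LR_algebra A3) -> u = A3.
  move=> u_A3; have := isomorphic_alternating u_A3 A3_alternating.
  case: u u_A3 => [a|b||] //; first by move=> _ /A1e1.
    by move=> _ /A2e2.
  by move=> /isomorphic_sym /not_A4.
case: s t => [a|b||] [c|d||] st //; try by [
    have := not_A3 _ st | have := not_A4 _ st
  | have := not_A3 _ (isomorphic_sym st) | have := not_A4 _ (isomorphic_sym st)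
  | have := A1_A2 _ _ st | have := A1_A2 _ _ (isomorphic_sym st)].
- congr A1; have := isomorphic_quadratic_invariant st (@A1_quadratic_invariant c).
  have comm : @commutator _ (LR_algebra (A1 a)) e1 e2 = e3.
    by rewrite /commutator /= !table_mul_delta subr0.
  move=> /(_ e1 e2 1 a 1); rewrite comm /= !table_mul_delta /= !scale1r.
  move=> /(_ erefl erefl erefl e3_neq0) <-.
  by rewrite mul1r subrr mulr0 subr0.
- congr A2; apply: A2_cubic_ratio_inj.
  exact: isomorphic_cubic_ratio st (@A2_cubic_ratio d).
Qed.

End Table.

Theorem proposition3p1 (R : realType) :
  [/\ forall s : LR_index R,
        @LR_structure_on R (heisenberg R) (amul (LR_algebra s)),
      forall A : nalgebra R,
        is_LR A -> isomorphic (associated_Lie A) (heisenberg R) ->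
        exists! s : LR_index R, isomorphic A (LR_algebra s),
      forall s : LR_index R, s <> A4 -> complete (LR_algebra s)
    & ~ complete (LR_algebra (@A4 R))].
Proof.
have two_neq0 : 2 != 0 :> R by rewrite Num.Theory.pnatr_eq0.
have three_neq0 : 3 != 0 :> R by rewrite Num.Theory.pnatr_eq0.
split; [exact: LR_table_structure | | exact: LR_complete | exact: A4_not_complete].
move=> A A_LR [f [[f' fK f'K] fM]].
have [s As] : exists s, isomorphic A (LR_algebra s).
  exact: (@LR_classification _ A f f').
exists s; split=> // t At.
exact: LR_isomorphic_eq (isomorphic_trans (isomorphic_sym As) At).
Qed.
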